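(* Let $a=x_0<x_1<\cdots<x_{N+1}=b$ be a partition of $\Omega=(a,b)$ with $h_j=x_j-x_{j-1}$, let $0<\delta<\infty$, let $\rho_\delta$ be an interaction kernel with horizon $\delta$, and let $\boldsymbol{S}_\delta\in\mathbb{R}^{N\times N}$ be the nonlocal piecewise linear FEM stiffness matrix (both as defined in the context). Let $$d_j^k=|x_j-x_k|,\qquad \boldsymbol{c}_j:=\Big(\frac1{h_j},\,-\frac1{h_j}-\frac1{h_{j+1}},\,\frac1{h_{j+1}}\Big),$$ and define $$g(z):=g(z;s):=-\frac1{12}\big(|z+s|^3-2|z|^3+|z-s|^3\big).$$ Then the stiffness matrix can be evaluated by the component-wise integral $$\boldsymbol{S}_\delta=\int_0^\delta \boldsymbol{I}(s)\,\rho_\delta(s)\,\mathrm{d}s,$$ where the matrix-valued function $\boldsymbol{I}(s)\in\mathbb{R}^{N\times N}$ has the entries $$\boldsymbol{I}_{jk}(s)=\boldsymbol{I}_{kj}(s)=\boldsymbol{c}_j\,g(\boldsymbol{D}_j^k)\,\boldsymbol{c}_k^\top,\qquad \boldsymbol{D}_j^k:=\begin{pmatrix} d_{j-1}^{k-1}&d_{j-1}^{k}&d_{j-1}^{k+1}\\ d_{j}^{k-1}&d_{j}^{k}&d_{j}^{k+1}\\ d_{j+1}^{k-1}&d_{j+1}^{k}&d_{j+1}^{k+1}\end{pmatrix},\qquad 1\le j,k\le N.$$ Here $g(\boldsymbol{D}_j^k)$ means that the function $g$ acts component-wise on the matrix $\boldsymbol{D}_j^k$.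
   Context: Interaction kernel with horizon $\delta$: a nonnegative radial function $\rho_\delta(s)=\rho_\delta(|s|)$, compactly supported in $|s|\le\delta$, with bounded second moment. Basis functions: $\Omega=(a,b)$ and $\Omega_\delta=[a-\delta,a]\cup[b,b+\delta]$. For $1\le j\le N$, $\phi_j$ is the hat function $\phi_j(x)=(x-x_{j-1})/h_j$ on $[x_{j-1},x_j]$, $\phi_j(x)=(x_{j+1}-x)/h_{j+1}$ on $(x_j,x_{j+1}]$, and $\phi_j(x)=0$ elsewhere on $\Omega\cup\Omega_\delta$. Stiffness matrix: $$(\boldsymbol{S}_\delta)_{jk}=(\boldsymbol{S}_\delta)_{kj}=\frac12\int_{\Omega}\int_{-\delta}^{\delta}(\phi_j(x+s)-\phi_j(x))(\phi_k(x+s)-\phi_k(x))\,\rho_\delta(|s|)\,\mathrm{d}s\,\mathrm{d}x,\qquad 1\le j,k\le N.$$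
   Formalization: The outer integral defining the stiffness matrix is taken over Ω∪Ω_δ instead of Ω; with Ω alone the formula fails, e.g. N=1, nodes 0,1,2, δ=1, ρ_δ=1 on [-1,1] gives 1/3 on the left and 5/12 on the right. *)

(* Defs.v *)
From HB Require Import structures.
From mathcomp Require Import all_boot all_order all_algebra.
From mathcomp Require Import all_classical all_reals all_analysis.
Set Implicit Arguments.
Unset Strict Implicit.
Unset Printing Implicit Defensive.
Import Order.TTheory GRing.Theory Num.Theory numFieldNormedType.Exports.
Local Open Scope classical_set_scope.
Local Open Scope ring_scope.

(** The value at [s = 0] is irrelevant (a null set), so kernels that are
    singular at the origin, such as [`|s| `^ (- 1 - 2 * alpha)] with
    [alpha < 1] cut off at [delta], are covered. *)
Definition interaction_kernel (R : realType) (delta : R) (rho : R -> R) : Prop :=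
  [/\ measurable_fun [set: R] rho,
      forall s, 0 <= rho s,
      forall s, rho s = rho `|s|,
      forall s, delta < `|s| -> rho s = 0
    & (\int[@lebesgue_measure R]_s (s ^+ 2 * rho s)%:E < +oo)%E].

(** The nodes [x_0 < ... < x_{N+1}] are the first [N+2] values of a sequence;
    the remaining values are never used. *)
Definition is_partition (R : realType) (a b : R) (N : nat) (x : nat -> R) : Prop :=
  [/\ x 0%N = a, x N.+1 = b & forall i, (i <= N)%N -> x i < x i.+1].

Definition mesh (R : realType) (x : nat -> R) (j : nat) : R := x j - x j.-1.

Definition Omega (R : realType) (a b : R) : set R := `]a, b[.

Definition Omega_delta (R : realType) (a b delta : R) : set R :=
  `[a - delta, a] `|` `[b, b + delta].

(** Used for [1 <= j <= N]. The function is extended by zero to the whole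
    line. *)
Definition hat (R : realType) (x : nat -> R) (j : nat) (t : R) : R :=
  if x j.-1 <= t <= x j then (t - x j.-1) / mesh x j
  else if x j < t <= x j.+1 then (x j.+1 - t) / mesh x j.+1
  else 0.

(** Ordinals [j : 'I_N] start at [0], so that [j] stands for the hat function
    number [j.+1].
    The outer variable ranges over [Omega `|` Omega_delta], not only over
    [Omega]. For [y] in [Omega_delta] the integrand need not vanish: it is
    [phi_j (y + s) * phi_k (y + s) * rho s]. Discarding these [y] strictly
    decreases the diagonal entries of the hat functions adjacent to [a] and
    [b] (unless [rho] is null) and breaks the closed form [I_mx] there. *)
Definition stiffness (R : realType) (a b delta : R) (rho : R -> R)
    (N : nat) (x : nat -> R) : 'M[R]_N :=
  \matrix_(j < N, k < N)
    (2^-1 * \int[@lebesgue_measure R]_(y in Omega a b `|` Omega_delta a b delta)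
              \int[@lebesgue_measure R]_(s in `[- delta, delta])
                ((hat x j.+1 (y + s) - hat x j.+1 y) *
                 (hat x k.+1 (y + s) - hat x k.+1 y) * rho `|s|)).

Definition node_dist (R : realType) (x : nat -> R) (j k : nat) : R := `|x j - x k|.

Definition c_row (R : realType) (x : nat -> R) (j : nat) : 'rV[R]_3 :=
  \row_(p < 3) [:: (mesh x j)^-1;
                   - (mesh x j)^-1 - (mesh x j.+1)^-1;
                   (mesh x j.+1)^-1]`_p.

Definition g (R : realType) (s z : R) : R :=
  - 12%:R^-1 * (`|z + s| ^+ 3 - 2 * `|z| ^+ 3 + `|z - s| ^+ 3).

(** Rows run over the nodes [j-1, j, j+1], columns over [k-1, k, k+1]. *)
Definition D_mx (R : realType) (x : nat -> R) (j k : nat) : 'M[R]_3 :=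
  \matrix_(p < 3, q < 3) node_dist x (j.-1 + p) (k.-1 + q).

Definition I_mx (R : realType) (N : nat) (x : nat -> R) (s : R) : 'M[R]_N :=
  \matrix_(j < N, k < N)
    (c_row x j.+1 *m map_mx (g s) (D_mx x j.+1 k.+1) *m (c_row x k.+1)^T) ord0 ord0.

Definition mx_integral (R : realType) (m n : nat) (A : set R)
    (F : R -> 'M[R]_(m, n)) : 'M[R]_(m, n) :=
  \matrix_(i < m, j < n) \int[@lebesgue_measure R]_(s in A) (F s i j).

(* Main.v *)
(** Write [K t = |t|^3 / 12], so that [K' t = t |t| / 4] and [K'' t = |t| / 2].
    Since [(|t| / 2)''] is a Dirac mass, [phi_j t = sum_p c_j(p) K'' (t - x_p)],
    the sum being over [p = j-1, j, j+1], and two integrations by parts give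
    [int phi_j W'' = sum_p c_j(p) W(x_p)] for every [C^2] function [W].
    Applied to the translates of [phi_j], with [W] a combination of translates
    of [K], this evaluates the inner integral over [y] for fixed [s] as [I(s)].
    Hat functions are Lipschitz, hence the double integrand is dominated by
    [C s^2 rho(s)]; Fubini and the parity of [s |-> rho(s) I(s)] conclude. *)

Require Import Defs.
From mathcomp Require Import all_boot all_order all_algebra.
From mathcomp Require Import all_classical all_reals all_analysis.
From mathcomp Require Import measurable_realfun.
From mathcomp Require Import ring lra.
Import Order.TTheory GRing.Theory Num.Theory numFieldNormedType.Exports.
Local Open Scope classical_set_scope.
Local Open Scope ring_scope.
Set Implicit Arguments.
Unset Strict Implicit.
Unset Printing Implicit Defensive.

(** * Derivatives of the cubed absolute value *)

(** The difference quotient at [0] is [h u] itself, so continuity of [h] suffices. This handles the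
    kink of [|t|], where the product rule does not apply. *)
Lemma is_derive_mul_id0 (R : realType) (h : R -> R) :
  {for 0, continuous h} -> is_derive (0 : R) (1 : R) (fun t => t * h t) (h 0).
Proof.
move=> h0.
have H : (fun u : R => u^-1 *: ((u *: (1 : R) + 0) * h (u *: (1 : R) + 0) - 0 * h 0))
    @ 0^' --> h 0.
  apply: (@cvg_trans _ (h @ 0^')); last first.
    by apply: cvg_within_filter; exact: h0.
  apply: near_eq_cvg; near=> u.
  rewrite mul0r subr0 addr0 /GRing.scale/= mulr1 mulrA mulVf ?mul1r//.
  by near: u; exact: nbhs_dnbhs_neq.
apply: DeriveDef; first by apply/cvg_ex; exists (h 0).
exact: cvg_lim H.
Unshelve. all: by end_near. Qed.

Lemma is_derive_mul_norm (R : realType) (t : R) :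
  is_derive t 1 (fun u : R => u * `|u|) (2 * `|t|).
Proof.
have [t0|t0|->] := ltgtP t 0.
- apply: (@near_eq_is_derive _ _ _ (fun u : R => u * - u)).
    near=> u; rewrite ltr0_norm//; near: u; exact: lt_nbhsl.
  by apply: is_derive_eq; rewrite ltr0_norm// /GRing.scale/=; ring.
- apply: (@near_eq_is_derive _ _ _ (fun u : R => u * u)).
    near=> u; rewrite gtr0_norm//; near: u; exact: lt_nbhsr.
  by apply: is_derive_eq; rewrite gtr0_norm// /GRing.scale/=; ring.
(* The derivative [0] is written back as [|0|], the value at [0] of the factor [h], here the
   norm. *)
- rewrite normr0 mulr0 -[X in is_derive _ _ _ X](@normr0 _ R).
  by apply: is_derive_mul_id0; exact: norm_continuous.
Unshelve. all: by end_near. Qed.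

Lemma is_derive_norm_cube (R : realType) (t : R) :
  is_derive t 1 (fun u : R => `|u| ^+ 3) (3 * (t * `|t|)).
Proof.
have -> : (fun u : R => `|u| ^+ 3) = (fun u => u * (u * `|u|)).
  by apply/funext => u; rewrite exprS real_normK ?num_real//; ring.
have d := is_derive_mul_norm t.
by apply: is_derive_eq; rewrite /GRing.scale/=; ring.
Qed.

(** * Hat functions and their integrals against second derivatives *)

(** The entries of [c_row] are the jumps of the slope at the three nodes, and [|t| / 2] has slope
    jump 1 at the origin. Beyond the outer nodes the sum vanishes because the jumps have zero sum
    and zero first moment. *)
Lemma hat_norms (R : realType) (x : nat -> R) (j : nat) (t : R) :
    x j < x j.+1 -> x j.+1 < x j.+2 ->
  hat x j.+1 t = 2^-1 * \sum_(p < 3) c_row x j.+1 ord0 p * `|t - x (j + p)%N|.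
Proof.
move=> h1 h2; rewrite !big_ord_recl big_ord0 !mxE/= /bump/= !(addn0, addnS).
rewrite /hat /mesh/= addr0.
have n1 : x j.+1 - x j != 0 by rewrite subr_eq0 gt_eqF.
have n2 : x j.+2 - x j.+1 != 0 by rewrite subr_eq0 gt_eqF.
have [a1|a1] := leP (x j) t; have [a2|a2] := leP t (x j.+1);
  have [a3|a3] := leP t (x j.+2) => /=; try (exfalso; lra).
all: first [rewrite (@ger0_norm _ (t - x j)); last lra
           |rewrite (@ler0_norm _ (t - x j)); last lra].
all: first [rewrite (@ger0_norm _ (t - x j.+1)); last lra
           |rewrite (@ler0_norm _ (t - x j.+1)); last lra].
all: first [rewrite (@ger0_norm _ (t - x j.+2)); last lra
           |rewrite (@ler0_norm _ (t - x j.+2)); last lra].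
all: by field; rewrite n1 n2.
Qed.

Lemma Rintegral_FTC2 (R : realType) (F f : R -> R) (a b : R) :
    a < b -> (forall t : R, is_derive t 1 F (f t)) -> continuous f ->
  \int[@lebesgue_measure R]_(t in `[a, b]) f t = F b - F a.
Proof.
move=> ab dF cf.
have cF : continuous F.
  by move=> t; apply/differentiable_continuous/derivable1_diffP; case: (dF t).
rewrite /Rintegral (@continuous_FTC2 _ f F)//.
- exact: continuous_subspaceT.
- split; first by move=> t _; case: (dF t).
  + exact/cvg_at_right_filter/cF.
  + exact/cvg_at_left_filter/cF.
- by move=> t _; rewrite derive1E; apply: derive_val; exact: dF.
Qed.

Lemma Rintegral_itv_split (R : realType) (f : R -> R) (a b c : R) :
    a <= b -> b <= c -> continuous f ->
  \int[@lebesgue_measure R]_(t in `[a, c]) f t =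
    \int[@lebesgue_measure R]_(t in `[a, b]) f t +
    \int[@lebesgue_measure R]_(t in `[b, c]) f t.
Proof.
move=> ab bc cf.
have fint u v : (@lebesgue_measure R).-integrable `[u, v] (EFin \o f).
  apply: continuous_compact_integrable; first exact: segment_compact.
  exact: continuous_subspaceT.
rewrite -(@Rintegral_itv_obnd_cbnd _ b); last first.
  by apply: integrableS (fint b c) => //; exact: subset_itv_oc_cc.
by rewrite -(@Rintegral_itvB _ f (BLeft a) (BRight c) b) ?bnd_simp// addrC subrK.
Qed.

Lemma hat_eq0 (R : realType) (x : nat -> R) (j : nat) (t : R) :
    x j < x j.+1 -> x j.+1 < x j.+2 -> ~~ (x j < t < x j.+2) ->
  hat x j.+1 t = 0.
Proof.
move=> h1 h2 tj; rewrite /hat /=.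
have {}tj : t <= x j \/ x j.+2 <= t.
  by move: tj; rewrite negb_and -!leNgt => /orP.
case: ifP => [/andP[a1 a2]|_].
  by rewrite (_ : t = x j) ?subrr ?mul0r//; lra.
case: ifP => [/andP[a1 a2]|//].
by rewrite (_ : t = x j.+2) ?subrr ?mul0r//; lra.
Qed.

Lemma hat_left (R : realType) (x : nat -> R) (j : nat) (t : R) :
  x j <= t <= x j.+1 -> hat x j.+1 t = (mesh x j.+1)^-1 * (t - x j).
Proof. by rewrite /hat/= mulrC => ->. Qed.

Lemma hat_right (R : realType) (x : nat -> R) (j : nat) (t : R) :
    x j < x j.+1 -> x j.+1 < x j.+2 -> x j.+1 <= t <= x j.+2 ->
  hat x j.+1 t = (mesh x j.+2)^-1 * (x j.+2 - t).
Proof.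
(* At the middle node [hat] takes its left branch; both formulas give 1 there. *)
move=> h1 h2 /andP[a1 a2]; rewrite /hat /mesh /=; case: ifP => [/andP[b1 b2]|b].
  have -> : t = x j.+1 by lra.
  by field; rewrite !subr_eq0 !gt_eqF.
case: ifP => [_|c]; first by rewrite mulrC.
by exfalso; move/negP: b; apply; move/negP: c; lra.
Qed.

Lemma hat_continuous (R : realType) (x : nat -> R) (j : nat) :
  x j < x j.+1 -> x j.+1 < x j.+2 -> continuous (hat x j.+1).
Proof.
move=> h1 h2; rewrite (_ : hat x j.+1 = fun t => 2^-1 *
    \sum_(p < 3) c_row x j.+1 ord0 p * `|t - x (j + p)%N|); last first.
  by apply/funext => t; exact: hat_norms.
move=> t; apply: cvgMr; apply: (@cvg_big _ _ +%R) => [|p _]; first exact: add_continuous.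
apply: cvgMr.
by apply: cvg_norm; apply: cvgB; [exact: cvg_id|exact: cvg_cst].
Qed.

(** Integrating by parts on each half of the support leaves a divided difference of [W] plus or
    minus the slope [W'] at the middle node. The two slopes cancel, and the divided differences
    combine into the weights [c_row]. The interval only has to contain the support. *)
Lemma hat_integral (R : realType) (x : nat -> R) (j : nat) (A B : R)
    (W W' w : R -> R) :
    x j < x j.+1 -> x j.+1 < x j.+2 -> A <= x j -> x j.+2 <= B ->
    (forall t : R, is_derive t 1 W (W' t)) ->
    (forall t : R, is_derive t 1 W' (w t)) -> continuous w ->
  \int[@lebesgue_measure R]_(t in `[A, B]) (hat x j.+1 t * w t) =
    \sum_(p < 3) c_row x j.+1 ord0 p * W (x (j + p)%N).
Proof.
move=> h1 h2 Aj jB dW dW' cw.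
have cf : continuous (fun t => hat x j.+1 t * w t).
  by move=> t; apply: cvgM; [exact: hat_continuous|exact: cw].
rewrite (@Rintegral_itv_split _ _ A (x j.+1) B) //; [|lra..].
rewrite (@Rintegral_itv_split _ _ A (x j) (x j.+1)) //; [|lra..].
rewrite (@Rintegral_itv_split _ _ (x j.+1) (x j.+2) B) //; [|lra..].
have z u v : v <= x j \/ x j.+2 <= u ->
    \int[@lebesgue_measure R]_(t in `[u, v]) (hat x j.+1 t * w t) = 0.
  move=> uv; rewrite (@eq_Rintegral _ _ _ _ _ (fun=> 0)) ?Rintegral_cst ?mul0r//.
  move=> t; rewrite inE/= in_itv/= => /andP[ut tv].
  by rewrite hat_eq0 ?mul0r//; apply/negP; lra.
rewrite (z A (x j)) ?(z (x j.+2) B) ?add0r ?addr0; [|by right|by left].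
have cW : continuous W'.
  by move=> t; apply/differentiable_continuous/derivable1_diffP; case: (dW' t).
have L : \int[@lebesgue_measure R]_(t in `[x j, x j.+1]) (hat x j.+1 t * w t) =
    (mesh x j.+1)^-1 * (W (x j) - W (x j.+1)) + W' (x j.+1).
  rewrite (@eq_Rintegral _ _ _ (@lebesgue_measure R) _
      (fun t : R => (mesh x j.+1)^-1 * ((t - x j) * w t))); last first.
    by move=> t; rewrite inE/= in_itv/= => tj; rewrite hat_left// mulrA.
  etransitivity.
  (* The derivative of [(t - x j) * W' t - W t] is [(t - x j) * w t]: the two [W'] terms cancel. *)
  apply: (@Rintegral_FTC2 _ (fun t => (mesh x j.+1)^-1 * ((t - x j) * W' t - W t))) => //.
  - move=> t; have ? := dW t; have ? := dW' t.
    by apply: is_derive_eq; rewrite /GRing.scale/=; ring.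
  - move=> t; apply: cvgMr; apply: cvgM; last exact: cw.
    by apply: cvgB; [exact: cvg_id|exact: cvg_cst].
  - by rewrite /mesh/=; field; rewrite subr_eq0 gt_eqF.
have Rt : \int[@lebesgue_measure R]_(t in `[x j.+1, x j.+2]) (hat x j.+1 t * w t) =
    (mesh x j.+2)^-1 * (W (x j.+2) - W (x j.+1)) - W' (x j.+1).
  rewrite (@eq_Rintegral _ _ _ (@lebesgue_measure R) _
      (fun t : R => (mesh x j.+2)^-1 * ((x j.+2 - t) * w t))); last first.
    by move=> t; rewrite inE/= in_itv/= => tj; rewrite hat_right// mulrA.
  etransitivity.
  apply: (@Rintegral_FTC2 _ (fun t => (mesh x j.+2)^-1 * ((x j.+2 - t) * W' t + W t))) => //.
  - move=> t; have ? := dW t; have ? := dW' t.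
    by apply: is_derive_eq; rewrite /GRing.scale/=; ring.
  - move=> t; apply: cvgMr; apply: cvgM; last exact: cw.
    by apply: cvgB; [exact: cvg_cst|exact: cvg_id].
  - by rewrite /mesh/=; field; rewrite subr_eq0 gt_eqF.
rewrite L Rt !big_ord_recl big_ord0 !mxE/= /bump/= !(addn0, addnS).
ring.
Qed.

(** * The inner integral for a fixed shift *)

Lemma is_derive_norm_shift (R : realType) (c t : R) :
  is_derive t 1 (fun u : R => 12^-1 * `|u + c| ^+ 3)
                (4^-1 * ((t + c) * `|t + c|)).
Proof.
have ds := is_derive_shift t 1 c.
have dc := is_derive_norm_cube (shift c t).
have d := is_derive1_comp dc ds.
rewrite (_ : (fun u => _) = (fun u => 12^-1 * ((fun v : R => `|v| ^+ 3) \o shift c) u))//.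
by apply: is_derive_eq; rewrite /GRing.scale/=; field.
Qed.

Lemma is_derive_mul_norm_shift (R : realType) (c t : R) :
  is_derive t 1 (fun u : R => 4^-1 * ((u + c) * `|u + c|)) (2^-1 * `|t + c|).
Proof.
have ds := is_derive_shift t 1 c.
have dc := is_derive_mul_norm (shift c t).
have d := is_derive1_comp dc ds.
rewrite (_ : (fun u => _) = (fun u => 4^-1 * ((fun v : R => v * `|v|) \o shift c) u))//.
by apply: is_derive_eq; rewrite /GRing.scale/=; field.
Qed.

Lemma is_derive_lincomb (R : realType) (n : nat) (c : 'I_n -> R)
    (f g df dg : 'I_n -> R -> R) (t : R) :
    (forall i, is_derive t 1 (f i) (df i t)) ->
    (forall i, is_derive t 1 (g i) (dg i t)) ->
  is_derive t 1 (fun u => \sum_(i < n) c i * (f i u - g i u))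
                (\sum_(i < n) c i * (df i t - dg i t)).
Proof.
move=> hf hg.
rewrite (_ : (fun u => _) = \sum_(i < n) (fun u => c i * (f i u - g i u))); last first.
  by apply/funext => u; rewrite fct_sumE.
have h i : is_derive t 1 (fun u => c i * (f i u - g i u)) (c i * (df i t - dg i t)).
  have ? := hf i; have ? := hg i.
  by apply: is_derive_eq; rewrite /GRing.scale/=; ring.
exact: is_derive_sum.
Qed.

(** Evenness in [z] lets signed differences of nodes replace the distances in [D_mx]. *)
Lemma g_norm (R : realType) (s z : R) : g s `|z| = g s z.
Proof.
rewrite /g normr_id; have [z0|z0] := ger0P z; first by [].
rewrite (_ : - z + s = - (z - s)); last ring.
rewrite (_ : - z - s = - (z + s)); last ring.
by rewrite !normrN; ring.
Qed.

Lemma gN (R : realType) (s z : R) : g (- s) z = g s z.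
Proof. by rewrite /g opprK; ring. Qed.

Lemma I_mxE (R : realType) (N : nat) (x : nat -> R) (s : R) (j k : 'I_N) :
  I_mx N x s j k = \sum_(p < 3) \sum_(q < 3)
    c_row x j.+1 ord0 p * c_row x k.+1 ord0 q * g s (x (j + p)%N - x (k + q)%N).
Proof.
rewrite mxE mxE exchange_big/=; apply: eq_bigr => q _.
rewrite !mxE big_distrl/=; apply: eq_bigr => p _.
by rewrite !mxE /node_dist g_norm mulrAC.
Qed.

Lemma I_mx_sym (R : realType) (N : nat) (x : nat -> R) (s : R) (j k : 'I_N) :
  I_mx N x s j k = I_mx N x s k j.
Proof.
rewrite !I_mxE exchange_big/=; apply: eq_bigr => p _; apply: eq_bigr => q _.
by rewrite -[in LHS]g_norm distrC g_norm (mulrC (c_row x j.+1 ord0 q)).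
Qed.

Lemma I_mxN (R : realType) (N : nat) (x : nat -> R) (s : R) (j k : 'I_N) :
  I_mx N x (- s) j k = I_mx N x s j k.
Proof.
by rewrite !I_mxE; apply: eq_bigr => p _; apply: eq_bigr => q _; rewrite gN.
Qed.

(** A translated hat is a hat on the translated mesh, whose widths are unchanged, so every result
    for an arbitrary mesh applies to it. *)
Lemma hat_shift (R : realType) (x : nat -> R) (j : nat) (s t : R) :
  hat x j (t + s) = hat (fun i => x i - s) j t.
Proof.
have m i : mesh (fun i => x i - s) i = mesh x i by rewrite /mesh; ring.
rewrite /hat !m !lerBlDr !ltrBlDr !lerBrDr opprB addrA (addrAC (x j.+1)).
by rewrite -(addrA (x j.+1)) -opprD (addrC t).
Qed.

Lemma hat_diff_continuous (R : realType) (x : nat -> R) (j : nat) (s : R) :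
    x j < x j.+1 -> x j.+1 < x j.+2 ->
  continuous (fun y => hat x j.+1 (y + s) - hat x j.+1 y).
Proof.
move=> h1 h2 y; apply: cvgB; last exact: hat_continuous.
rewrite (_ : (fun y => _) = hat (fun i => x i - s) j.+1).
  by rewrite hat_shift; apply: hat_continuous; rewrite ltrD2r.
by apply/funext => z; rewrite hat_shift.
Qed.

(** The difference in [k] plays the role of [W''], and only the hats in [j] are integrated against
    it. The margins [|s|] keep the supports of both the hat [j.+1] and its translate inside the
    interval. *)
Lemma hat_diff_integral (R : realType) (x : nat -> R) (N : nat) (A B s : R)
    (j k : 'I_N) :
    (forall i, (i <= N)%N -> x i < x i.+1) ->
    A + `|s| <= x j -> x j.+2 + `|s| <= B ->
  \int[@lebesgue_measure R]_(y in `[A, B])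
      ((hat x j.+1 (y + s) - hat x j.+1 y) * (hat x k.+1 (y + s) - hat x k.+1 y))
  = I_mx N x s j k.
Proof.
move=> hx Aj jB.
have hxl (i : 'I_N) : x i < x i.+1 by apply: hx; exact: ltnW.
have hxr (i : 'I_N) : x i.+1 < x i.+2 by apply: hx.
have s1 := ler_norm s; have s2 := ler_norm (- s); rewrite normrN in s2.
pose u y := hat x k.+1 (y + s) - hat x k.+1 y.
have cshift (i : 'I_N) : continuous (fun y => hat x i.+1 (y + s)).
  rewrite (_ : (fun y => _) = hat (fun i => x i - s) i.+1).
    by apply: hat_continuous; rewrite ltrD2r.
  by apply/funext => y; rewrite hat_shift.
have cu : continuous u.
  exact: hat_diff_continuous.
pose n q : R := x (k + q)%N.
pose c (q : 'I_3) := c_row x k.+1 ord0 q.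
pose K (r t : R) := 12^-1 * `|t + r| ^+ 3.
pose K' (r t : R) := 4^-1 * ((t + r) * `|t + r|).
pose K'' (r t : R) := 2^-1 * `|t + r|.
(* By [hat_norms], [u] is a combination of shifted [K'']; the same combination of the cubic kernels
   [K] is a second antiderivative of [u]. *)
pose W t := \sum_(q < 3) c q * (K (s - n q) t - K (- n q) t).
pose W' t := \sum_(q < 3) c q * (K' (s - n q) t - K' (- n q) t).
have dW (t : R) : is_derive t 1 W (W' t).
  apply: (@is_derive_lincomb _ _ c (fun q => K (s - n q)) (fun q => K (- n q))
    (fun q => K' (s - n q)) (fun q => K' (- n q))) => q;
    exact: is_derive_norm_shift.
have uE t : u t = \sum_(q < 3) c q * (K'' (s - n q) t - K'' (- n q) t).
  rewrite /u !hat_norms// -mulrBr -sumrB mulr_sumr; apply: eq_bigr => q _.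
  by rewrite /K'' /c /n addrA; ring.
have dW' (t : R) : is_derive t 1 W' (u t).
  rewrite uE; apply: (@is_derive_lincomb _ _ c (fun q => K' (s - n q))
    (fun q => K' (- n q)) (fun q => K'' (s - n q)) (fun q => K'' (- n q))) => q;
    exact: is_derive_mul_norm_shift.
have fint f : continuous f ->
    (@lebesgue_measure R).-integrable `[A, B] (EFin \o f).
  move=> cf; apply: continuous_compact_integrable; first exact: segment_compact.
  exact: continuous_subspaceT.
transitivity (\int[@lebesgue_measure R]_(y in `[A, B])
    (hat x j.+1 (y + s) * u y - hat x j.+1 y * u y)).
  by apply: eq_Rintegral => y _; rewrite -mulrBl.
rewrite RintegralB//; last 2 first.
- by apply: fint => y; apply: cvgM; [exact: cshift|exact: cu].
- by apply: fint => y; apply: cvgM; [exact: hat_continuous|exact: cu].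
rewrite (hat_integral (W := W) (W' := W')) //; [|lra..].
under eq_Rintegral do rewrite hat_shift.
rewrite (hat_integral (W := W) (W' := W')) ?ltrD2r //; [|lra..].
rewrite I_mxE -sumrB; apply: eq_bigr => p _.
(* The weights depend on mesh widths only, so both hats carry the same ones and the values
   [W (x_p - s) - W (x_p)] can be paired. *)
have -> : c_row (fun i => x i - s) j.+1 ord0 p = c_row x j.+1 ord0 p.
  by rewrite !mxE /mesh !opprB !addrA !subrK.
rewrite -mulrBr -sumrB mulr_sumr; apply: eq_bigr => q _.
rewrite -/(n q) -/(c q) /K /g.
(* With [z = x_p - x_q] and [K] unshifted, the four terms add up to [2 K(z) - K(z - s) - K(z + s)],
   which is [g s z]. *)
rewrite (_ : x (j + p)%N - s + (s - n q) = x (j + p)%N - n q); last ring.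
rewrite (_ : x (j + p)%N - s + (- n q) = x (j + p)%N - n q - s); last ring.
rewrite (_ : x (j + p)%N + (s - n q) = x (j + p)%N - n q + s); last ring.
by field.
Qed.

(** * Exchange of integrals and parity *)

(** A bound depending on [s] alone gives integrability on the product because [A] has finite
    measure. The second conclusion makes the integrated function available for the later parity
    argument. *)
Lemma Rintegral_exchange_dominated d1 d2 (T1 : measurableType d1)
    (T2 : measurableType d2) (R : realType)
    (m1 : {sigma_finite_measure set T1 -> \bar R})
    (m2 : {sigma_finite_measure set T2 -> \bar R})
    (A : set T1) (B : set T2) (F : T1 * T2 -> R) (G : T2 -> R) :
    measurable A -> measurable B -> (m1 A < +oo)%E ->
    measurable_fun [set: T1 * T2] F -> m2.-integrable B (EFin \o G) ->
    (forall y s, A y -> B s -> `|F (y, s)| <= G s) ->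
  \int[m1]_(y in A) \int[m2]_(s in B) F (y, s) =
    \int[m2]_(s in B) \int[m1]_(y in A) F (y, s) /\
  m2.-integrable B (EFin \o (fun s => \int[m1]_(y in A) F (y, s))).
Proof.
move=> mA mB Afin mF iG FG.
have mFl y : measurable_fun [set: T2] (fun s => F (y, s)).
  by apply: measurableT_comp => //; exact: pair1_measurable.
have mFr s : measurable_fun [set: T1] (fun y => F (y, s)).
  by apply: measurableT_comp => //; exact: pair2_measurable.
have iFl y : A y -> m2.-integrable B (EFin \o (fun s => F (y, s))).
  move=> Ay; apply: le_integrable iG => //.
    by apply/measurable_EFinP; exact: measurable_funTS.
  by move=> s Bs /=; rewrite lee_fin (le_trans (FG y s Ay Bs))// ler_norm.
have iFr s : B s -> m1.-integrable A (EFin \o (fun y => F (y, s))).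
  move=> Bs; apply: (@le_integrable _ _ _ _ _ mA _ (EFin \o cst (G s))).
  - by apply/measurable_EFinP; exact: measurable_funTS.
  - by move=> y Ay /=; rewrite lee_fin (le_trans (FG y s Ay Bs))// ler_norm.
  - apply/integrableP; split; first exact/measurable_EFinP.
    by rewrite /= integral_cst// lte_mul_pinfty.
(* Extension by zero outside the rectangle reduces the claim to Fubini on the full product space. *)
pose f : T1 * T2 -> \bar R := (EFin \o F) \_ (A `*` B).
have mf : measurable_fun [set: T1 * T2] f.
  apply/(measurable_restrictT _ _).1; first exact: measurableX.
  by apply/measurable_EFinP; exact: measurable_funTS.
have fl y : (\int[m2]_s f (y, s) =
    ((fun y => \int[m2]_(s in B) (F (y, s))%:E) \_ A) y)%E.
  rewrite patchE; case: ifPn => yA.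
    rewrite [RHS]integral_mkcond; apply: eq_integral => s _.
    by rewrite /f !patchE in_setX yA.
  by apply: integral0_eq => s _; rewrite /f patchE in_setX (negbTE yA).
have fr s : (\int[m1]_y f (y, s) =
    ((fun s => \int[m1]_(y in A) (F (y, s))%:E) \_ B) s)%E.
  rewrite patchE; case: ifPn => sB.
    rewrite [RHS]integral_mkcond; apply: eq_integral => y _.
    by rewrite /f !patchE in_setX sB andbT.
  by apply: integral0_eq => y _; rewrite /f patchE in_setX (negbTE sB) andbF.
have fi : (m1 \x m2)%E.-integrable [set: T1 * T2] f.
  apply/integrable12ltyP => //.
  have iG' : (\int[m2]_(s in B) `|(G s)%:E| < +oo)%E by case/integrableP: iG.
  (* The iterated integral of [|f|] is at most the measure of [A] times the integral of [|G|], which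
     is finite. *)
  apply: (@le_lt_trans _ _
    (\int[m1]_(y in A) (cst (\int[m2]_(s in B) `|(G s)%:E|) y))%E); last first.
    by rewrite integral_cst// lte_mul_pinfty ?integral_ge0// ge0_fin_numE ?integral_ge0.
  rewrite [leRHS]integral_mkcond; apply: ge0_le_integral => //.
  - by move=> y _; exact: integral_ge0.
  - have mf' : measurable_fun [set: T1 * T2] (abse \o f) by exact: measurableT_comp.
    by apply: (measurable_fun_fubini_tonelli_F (m2 := m2) (abse \o f) mf') => z /=.
  - by apply: (measurable_restrictT _ mA).1; exact: measurable_cst.
  - move=> y _; rewrite patchE; case: ifPn => yA.
      rewrite [leRHS]integral_mkcond; apply: ge0_le_integral => //.
      + by apply: measurableT_comp => //; apply: measurableT_comp mf _;
          exact: pair1_measurable.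
      + apply: (measurable_restrictT _ mB).1; apply: measurableT_comp => //.
        exact: measurable_int iG.
      + move=> s _; rewrite /f !patchE in_setX yA/=; case: ifPn => [sB|_].
          have FGs := FG y s (set_mem yA) (set_mem sB).
          by rewrite /= lee_fin (le_trans FGs)// ler_norm.
        by rewrite abse0.
    rewrite integral0_eq// => s _.
    by rewrite /f patchE in_setX (negbTE yA)/= normr0.
(* A real integral is the [fine] part of an extended one, which sends infinities to [0]; finiteness
   of the sections makes the passage faithful. *)
have fin_l : {in A, forall y, (\int[m2]_(s in B) F (y, s))%:E =
    (\int[m2]_(s in B) (F (y, s))%:E)%E}.
  by move=> y /[!inE] Ay; rewrite fineK//; exact: integrable_fin_num (iFl _ Ay).
have fin_r : {in B, forall s, (\int[m1]_(y in A) F (y, s))%:E =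
    (\int[m1]_(y in A) (F (y, s))%:E)%E}.
  by move=> s /[!inE] Bs; rewrite fineK//; exact: integrable_fin_num (iFr _ Bs).
split.
  congr fine; rewrite (eq_integral _ _ fin_l) (eq_integral _ _ fin_r).
  rewrite [LHS]integral_mkcond [RHS]integral_mkcond.
  under eq_integral do rewrite -fl.
  under [RHS]eq_integral do rewrite -fr.
  exact: Fubini.
apply: (@le_integrable _ _ _ _ _ mB _ (EFin \o (fun s => fine (m1 A) * G s))).
- apply: (@eq_measurable_fun _ _ _ _ B (fun s => \int[m1]_(y in A) (F (y, s))%:E)%E).
    by move=> s sB; rewrite /= fin_r.
  apply/(measurable_restrictT _ mB).2.
  rewrite (_ : _ \_ _ = fun s => (\int[m1]_y f (y, s))%E); last first.
    by apply/funext => s; rewrite fr.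
  exact: measurable_fubini_G fi.
- move=> s Bs; rewrite /= lee_fin.
  have iGs : m1.-integrable A (EFin \o cst (G s)).
    apply/integrableP; split; first exact/measurable_EFinP.
    by rewrite /= integral_cst// lte_mul_pinfty.
  apply: (le_trans (le_normr_Rintegral mA (iFr s Bs))).
  apply: le_trans (ler_norm _); rewrite mulrC -Rintegral_cst//.
  apply: le_Rintegral => // [|y Ay]; last exact: FG.
  exact: integrable_norm (iFr s Bs).
- rewrite (_ : _ \o _ = fun s => ((fine (m1 A))%:E * (G s)%:E)%E); last first.
    by apply/funext => s; rewrite /= EFinM.
  exact: integrableZl.
Qed.

Lemma Rintegral_even (R : realType) (f : R -> R) (r : R) :
    0 <= r -> measurable_fun [set: R] f ->
    (@lebesgue_measure R).-integrable `[- r, r] (EFin \o f) ->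
    (forall s, f (- s) = f s) ->
  \int[@lebesgue_measure R]_(s in `[- r, r]) f s =
    2 * \int[@lebesgue_measure R]_(s in `[0, r]) f s.
Proof.
move=> r0 mf fint fN.
have Nr0 : - r <= 0 by rewrite oppr_le0.
have fint0 : (@lebesgue_measure R).-integrable `[0, r] (EFin \o f).
  apply: integrableS fint => //; apply: subset_itvr; by rewrite bnd_simp.
have fintN : (@lebesgue_measure R).-integrable `[- r, 0] (EFin \o f).
  apply: integrableS fint => //; apply: subset_itvl; by rewrite bnd_simp.
have := @Rintegral_itvB _ f (BLeft (- r)) (BRight r) 0 fint.
rewrite !bnd_simp => /(_ Nr0 r0).
rewrite Rintegral_itv_obnd_cbnd; last first.
  by apply: integrableS fint0 => //; exact: subset_itv_oc_cc.
suff -> : \int[@lebesgue_measure R]_(s in `[- r, 0]) f s =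
    \int[@lebesgue_measure R]_(s in `[0, r]) f s by lra.
congr fine.
have pre : (-%R : R -> measurableTypeR R) @^-1` `[0, r] = `[- r, 0]%classic.
  by rewrite opp_preimage_itvbndbnd oppr0.
(* Change of variables [s] to [-s]: Lebesgue measure is its own pushforward under negation, and
   [[0, r]] pulls back to [[-r, 0]]. *)
transitivity (\int[pushforward (@lebesgue_measure R) (-%R : R -> measurableTypeR R)]_(s in `[0%R, r]) (f s)%:E)%E.
  rewrite integral_pushforward//.
  - by rewrite pre; apply: eq_integral => s _ /=; rewrite fN.
  - exact/measurable_EFinP.
  - by rewrite pre; apply: eq_integrable fintN => // s _ /=; rewrite fN.
by apply: eq_measure_integral => A mA _; exact: lebesgue_measureN.
Qed.

(** * Domination, the geometry of the domain, and the assembly *)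

(** Each [|t - x_p|] in [hat_norms] is 1-Lipschitz, so half the sum of the absolute slope jumps is a
    Lipschitz constant. *)
Lemma hat_lipschitz (R : realType) (x : nat -> R) (j : nat) (t u : R) :
    x j < x j.+1 -> x j.+1 < x j.+2 ->
  `|hat x j.+1 t - hat x j.+1 u| <=
    2^-1 * (\sum_(p < 3) `|c_row x j.+1 ord0 p|) * `|t - u|.
Proof.
move=> h1 h2; rewrite !hat_norms// -mulrBr normrM (@ger0_norm _ 2^-1)//.
rewrite -mulrA ler_pM2l// -sumrB mulr_suml.
apply: (le_trans (ler_norm_sum _ _ _)); apply: ler_sum => p _.
rewrite -mulrBr normrM ler_wpM2l//; apply: (le_trans (ler_dist_dist _ _)).
by rewrite opprB addrA subrK.
Qed.

Lemma is_partition_bounds (R : realType) (a b : R) (N : nat) (x : nat -> R) :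
  is_partition a b N x -> forall i, (i <= N.+1)%N -> a <= x i <= b.
Proof.
move=> [<- <- hx] i iN.
have mono m n : (m + n <= N.+1)%N -> x m <= x (m + n)%N.
  elim: n => [|n IH]; first by rewrite addn0.
  by rewrite addnS => mn; rewrite (le_trans (IH (ltnW mn)))// ltW// hx.
by rewrite -[i in x 0 <= x i]add0n mono//= -[in x N.+1](subnKC iN) mono// subnKC.
Qed.

(** The collars give a single compact interval with margin [delta] beyond [a] and [b], exactly the
    room that shifts with [|s| <= delta] require. *)
Lemma Omega_closure (R : realType) (a b delta : R) : a <= b -> 0 < delta ->
  Omega a b `|` Omega_delta a b delta = `[a - delta, b + delta]%classic.
Proof.
move=> ab d0; rewrite /Omega /Omega_delta; apply/seteqP; split => t /=;
  rewrite !in_itv/=.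
  by move=> [|[|]] /andP[h1 h2]; apply/andP; split; lra.
move=> /andP[h1 h2]; have [ta|ta] := leP t a; first by right; left; lra.
by have [tb|tb] := ltP t b; [left; lra|right; right; lra].
Qed.

Lemma measurable_I_mx (R : realType) (N : nat) (x : nat -> R) (j k : 'I_N) :
  measurable_fun [set: R] (fun s => I_mx N x s j k).
Proof.
rewrite (_ : (fun s => _) = fun s => \sum_(p < 3) \sum_(q < 3)
    c_row x j.+1 ord0 p * c_row x k.+1 ord0 q * g s (x (j + p)%N - x (k + q)%N)).
  apply: measurable_sum => p; apply: measurable_sum => q.
  apply: measurable_funM => //; apply: measurable_funM => //.
  have mn (f : R -> R) : measurable_fun [set: R] f ->
      measurable_fun [set: R] (fun s => `|f s| ^+ 3).
    by move=> mf; apply: measurable_funX; exact: measurableT_comp.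
  apply: measurable_funD; last by apply: mn; exact: measurable_funB.
  by apply: measurable_funB => //; apply: mn; exact: measurable_funD.
by apply/funext => s; rewrite I_mxE.
Qed.

Lemma integrable_second_moment (R : realType) (delta : R) (rho : R -> R)
    (A : set R) : measurable A -> interaction_kernel delta rho ->
  (@lebesgue_measure R).-integrable A (EFin \o (fun s => s ^+ 2 * rho s)).
Proof.
move=> mA [mrho rho0 _ _ fin].
apply: (@integrableS _ _ _ (@lebesgue_measure R) [set: R]) => //.
apply/integrableP; split.
  by apply/measurable_EFinP; apply: measurable_funM => //; exact: measurable_funX.
under eq_integral => s _.
  rewrite (_ : `|_|%E = (s ^+ 2 * rho s)%:E); last first.
    by rewrite /= ger0_norm// mulr_ge0// sqr_ge0.
  over.
exact: fin.
Qed.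

Theorem theorem1 (R : realType) (a b : R) (N : nat) (x : nat -> R)
    (delta : R) (rho : R -> R)
    (hx : is_partition a b N x)
    (hdelta : 0 < delta)
    (hrho : interaction_kernel delta rho) :
  stiffness a b delta rho N x
    = mx_integral `[0, delta] (fun s : R => rho s *: I_mx N x s)
  /\ (forall (s : R) (j k : 'I_N), I_mx N x s j k = I_mx N x s k j).
Proof.
split; last by move=> s j k; exact: I_mx_sym.
apply/matrixP => j k; rewrite !mxE.
have [_ _ xS] := hx.
have xl (i : 'I_N) : x i < x i.+1 by apply: xS; exact: ltnW.
have xr (i : 'I_N) : x i.+1 < x i.+2 by apply: xS.
have bnd := is_partition_bounds hx.
have ab : a <= b by have /andP[ax xb] := bnd 0%N (leq0n _); exact: le_trans xb.
have [mrho rho0 rhoN _ _] := hrho.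
rewrite Omega_closure//.
pose L (i : 'I_N) : R := 2^-1 * \sum_(p < 3) `|c_row x i.+1 ord0 p|.
pose du (i : 'I_N) (y s : R) := hat x i.+1 (y + s) - hat x i.+1 y.
pose F (z : R * R) := du j z.1 z.2 * du k z.1 z.2 * rho `|z.2|.
(* Each of the two hat differences contributes a factor [|s|], so the finite second moment of [rho]
   makes the bound integrable even for singular kernels. *)
pose G (s : R) : R := L j * L k * (s ^+ 2 * rho s).
have duL i y s : `|du i y s| <= L i * `|s|.
  apply: (le_trans (hat_lipschitz _ _ _ _)) => //.
  by rewrite (addrC y) addrK.
have mhat (i : 'I_N) : measurable_fun [set: R] (hat x i.+1).
  by apply: continuous_measurable_fun; exact: hat_continuous.
have mdu i : measurable_fun [set: R * R] (fun z => du i z.1 z.2).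
  apply: measurable_funB; apply: measurableT_comp => //.
  exact: measurable_funD.
have mF : measurable_fun [set: R * R] F.
  apply: measurable_funM; first exact: measurable_funM.
  by apply: measurableT_comp => //; apply: measurableT_comp.
have iG : (@lebesgue_measure R).-integrable `[- delta, delta] (EFin \o G).
  rewrite (_ : _ \o _ =
      fun s : R => ((L j * L k)%:E * (s ^+ 2 * rho s)%:E)%E).
    apply: integrableZl => //; apply: (integrable_second_moment _ hrho) => //.
  by apply/funext => s; rewrite /= -EFinM.
have FG (y s : R) : `[a - delta, b + delta]%classic y -> `[- delta, delta]%classic s ->
    `|F (y, s)| <= G s.
  move=> _ _; rewrite /F /G /= -rhoN 2!normrM (ger0_norm (rho0 s)) mulrA.
  apply: ler_wpM2r => //; rewrite -real_normK ?num_real// expr2 mulrACA.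
  by apply: ler_pM.
have Afin : (@lebesgue_measure R `[(a - delta)%R, (b + delta)%R] < +oo)%E.
  by apply: compact_finite_measure; exact: segment_compact.
have [FE iF] := Rintegral_exchange_dominated
  (m1 := @lebesgue_measure R) (m2 := @lebesgue_measure R) (measurable_itv _) (measurable_itv _) Afin mF iG FG.
have inner s : s \in `[- delta, delta]%classic ->
    \int[@lebesgue_measure R]_(y in `[a - delta, b + delta]) F (y, s)
    = rho s * I_mx N x s j k.
  rewrite inE/= in_itv/= => /andP[ds sd].
  have sdelta : `|s| <= delta by rewrite ler_norml ds.
  (* The hat for the ordinal [j] is supported on [[x j, x j.+2]], and [j < N] puts both ends between
     [a] and [b]. *)
  have /andP[axj _] := bnd j (leqW (ltnW (ltn_ord j))).
  have /andP[_ xjb] := bnd j.+2 (ltn_ord j).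
  have Aj : a - delta + `|s| <= x j.
    by apply: le_trans axj; rewrite -addrA gerDl addrC subr_le0.
  have jB : x j.+2 + `|s| <= b + delta by exact: lerD.
  rewrite -(hat_diff_integral k xS Aj jB).
  rewrite /F /= -rhoN RintegralZr; first by rewrite mulrC.
    exact: measurable_itv.
  apply: continuous_compact_integrable; first exact: segment_compact.
  apply: continuous_subspaceT => y.
  by apply: cvgM; exact: hat_diff_continuous.
transitivity (2^-1 * \int[@lebesgue_measure R]_(s in `[- delta, delta])
    (rho s * I_mx N x s j k)).
  congr (_ * _); apply: (etrans FE); exact: eq_Rintegral.
(* The integrand is even in [s], and the resulting factor 2 cancels the prefactor one half of the
   stiffness matrix. *)
rewrite Rintegral_even.
- rewrite mulrA mulVf ?mul1r ?pnatr_eq0//.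
  by apply: eq_Rintegral => s _; rewrite [RHS]mxE.
- exact: ltW.
- by apply: measurable_funM => //; exact: measurable_I_mx.
(* Integrability comes from the exchange lemma, since [inner] identifies the integrated function on
   the symmetric interval. *)
- by apply: eq_integrable iF => // s sB; rewrite /= inner.
- by move=> s; rewrite I_mxN rhoN normrN -rhoN.
Qed.
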